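(* Let $\pi$ be an order-$q$-subplane of $\mathrm{PG}(2,q^3)$ exterior to $\ell_\infty$. Then in $\mathrm{PG}(6,q)$, the corresponding set $[\pi]$ is the intersection of nine quadrics.
   Context: Let $q$ be a prime power and let $\tau$ be a primitive element of $\mathbb F_{q^3}$. For $\alpha=a_0+a_1\tau+a_2\tau^2\in\mathbb F_{q^3}$ with $a_i\in\mathbb F_q$, write $[\alpha]=(a_0,a_1,a_2)$. In $\mathrm{PG}(2,q^3)$, with homogeneous coordinates $(x,y,z)$, $\ell_\infty$ is the line $z=0$. In $\mathrm{PG}(6,q)$, with homogeneous coordinates $(x_0,x_1,x_2,y_0,y_1,y_2,z)$, $\Sigma_\infty$ is the hyperplane $z=0$. The Bruck-Bose correspondence sends a point $(\alpha,\beta,1)$ of $\mathrm{PG}(2,q^3)\setminus\ell_\infty$ to the point $([\alpha],[\beta],1)$ of $\mathrm{PG}(6,q)\setminus\Sigma_\infty$. An order-$q$-subplane of $\mathrm{PG}(2,q^3)$ is an image of $\mathrm{PG}(2,q)$ under $\mathrm{PGL}(3,q^3)$; it is exterior to $\ell_\infty$ if none of its points lies on $\ell_\infty$. For such a subplane $\pi$, $[\pi]$ denotes the set of $q^2+q+1$ points of $\mathrm{PG}(6,q)\setminus\Sigma_\infty$ corresponding to the points of $\pi$. A quadric of $\mathrm{PG}(6,q)$ is the zero set of a homogeneous quadratic polynomial in the seven coordinates over $\mathbb F_q$. *)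

(* Defs.v *)
From HB Require Import structures.
From mathcomp Require Import all_boot all_order all_algebra all_field.
From mathcomp Require Import boolp classical_sets.
From mathcomp Require Import mpoly.

Set Implicit Arguments.
Unset Strict Implicit.
Unset Printing Implicit Defensive.

Import GRing.Theory.

Local Open Scope classical_set_scope.
Local Open Scope ring_scope.

Definition PG (n : nat) (K : fieldType) : set {vspace 'rV[K]_n.+1} :=
  [set P | \dim P = 1%N].
Arguments PG n K _ : clear implicits.

Definition line_at_infinity (K : fieldType) : set {vspace 'rV[K]_3} :=
  [set P | PG 2 K P /\ forall v, v \in P -> v 0 ord_max = 0].
Arguments line_at_infinity K _ : clear implicits.

(* The points of PG(2, L) that have homogeneous coordinates in F. *)
Definition canonical_subplane (F : fieldType) (L : fieldExtType F) :
    set {vspace 'rV[L]_3} :=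
  [set <[map_mx (in_alg L) v]>%VS | v in [set v : 'rV[F]_3 | v != 0]].
Arguments canonical_subplane {F} L _.

Definition projectivity (K : fieldType) (n : nat) (A : 'M[K]_n.+1)
    (P : {vspace 'rV[K]_n.+1}) : {vspace 'rV[K]_n.+1} :=
  (linfun (mulmxr A) @: P)%VS.

Definition is_subplane (F : fieldType) (L : fieldExtType F)
    (pi : set {vspace 'rV[L]_3}) : Prop :=
  exists2 A : 'M[L]_3, A \in unitmx &
    pi = projectivity A @` canonical_subplane L.

Definition exterior (K : fieldType) (pi : set {vspace 'rV[K]_3}) : Prop :=
  pi `&` line_at_infinity K = set0.

(* When tau is a primitive element of an extension L of degree 3, the tuple    *)
(* (1, tau, tau^2) is an F-basis of L, so that `coord` gives the unique        *)
(* (a_0, a_1, a_2) with alpha = a_0 + a_1 tau + a_2 tau^2.                     *)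
Definition bracket (F : fieldType) (L : fieldExtType F) (tau alpha : L) :
    'rV[F]_3 :=
  \row_(i < 3) coord [tuple tau ^+ j | j < 3] i alpha.

Definition affine_point (K : fieldType) (alpha beta : K) :
    {vspace 'rV[K]_3} :=
  <[(\row_(i < 3) [:: alpha; beta; 1]`_i)%R]>%VS.

Definition bruck_bose_point (F : fieldType) (L : fieldExtType F)
    (tau alpha beta : L) : {vspace 'rV[F]_7} :=
  <[row_mx (row_mx (bracket tau alpha) (bracket tau beta)) (const_mx 1%R)
     : 'rV[F]_(3 + 3 + 1)]>%VS.

Definition bruck_bose (F : fieldType) (L : fieldExtType F) (tau : L)
    (pi : set {vspace 'rV[L]_3}) : set {vspace 'rV[F]_7} :=
  [set P | exists alpha beta : L,
     pi (affine_point alpha beta) /\ P = bruck_bose_point tau alpha beta].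

Definition zero_locus (K : fieldType) (n : nat) (f : {mpoly K[n.+1]}) :
    set {vspace 'rV[K]_n.+1} :=
  [set P | PG n K P /\ forall v, v \in P -> f.@[fun i => v 0 i] = 0].

(* The predicate `2.-homog` also holds of the zero polynomial, which does not  *)
(* define a quadric.                                                           *)
Definition is_quadric (K : fieldType) (n : nat)
    (S : set {vspace 'rV[K]_n.+1}) : Prop :=
  exists f : {mpoly K[n.+1]}, [/\ f != 0, f \is 2.-homog & S = zero_locus f].

(* Main.v *)
Require Import Defs.
From HB Require Import structures.
From mathcomp Require Import all_boot all_order all_algebra all_field.
From mathcomp Require Import boolp classical_sets.
From mathcomp Require Import mpoly.
From mathcomp Require Import ring.

Set Implicit Arguments.
Unset Strict Implicit.
Unset Printing Implicit Defensive.

Import GRing.Theory.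

Local Open Scope classical_set_scope.
Local Open Scope ring_scope.

(** Write q = #|F| and let the subplane be the image of PG(2, q) under the
    invertible matrix A.  A point <w A> of PG(2, q^3) lies on it exactly when
    the row vector w in L^3 is proportional to a vector with entries in F.
    Since F is the fixed field of the Frobenius map x |-> x^q, this amounts to
    w being proportional to its conjugate, that is, to the vanishing of the
    three minors w_i w_j^q - w_j w_i^q ([frobenius_minors_eq0]).

    A vector u of F^7 encodes (alpha, beta, z) with alpha, beta in L and z in
    F, and w = (alpha, beta, z) A^-1 is an F-linear function of u.  So is w^q,
    hence each minor is a quadratic form in u with values in L.  Its three
    coordinates over F are ordinary quadratic forms
    ([frobenius_minor_quadratic]), which makes nine quadrics.  They have no
    common point in the hyperplane z = 0: such a point would give a point of
    the subplane on the line at infinity.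

    It remains to see that the nine forms are nonzero and have distinct zero
    loci.  For each of them there is a point at which it does not vanish but
    the other eight do, and this point can be found with z = 0.  Let c be the
    last column of A, so that z = w c.  Exteriority of the subplane says that
    the entries of c are linearly independent over F ([exterior_col_free]).
    If one entry of w is zero and the other two are s c_j and - s c_i, then
    w c = 0, only one minor survives, and it equals s^(q+1) times a nonzero
    constant.  When [L : F] = 3, every element of L is s^(q+1) for some s, up
    to a nonzero factor in F ([pow_frobenius_succ_onto]); hence the surviving
    minor can be made proportional to any chosen element of the basis of L
    over F ([single_frobenius_minor]). *)

(** * Linear algebra and projective points *)

Lemma mulmx_col (R : pzSemiRingType) m n p
    (B : 'M[R]_(m, n)) (A : 'M_(n, p)) i j :
  (B *m col j A) i 0 = (B *m A) i j.
Proof. by rewrite !mxE; apply: eq_bigr => k _; rewrite mxE. Qed.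

Section Lines.
Variable K : fieldType.

Lemma vlineZ (V : vectType K) (x : K) (v : V) :
  x != 0 -> <[x *: v]>%VS = <[v]>%VS.
Proof.
move=> x0; apply/eqP; rewrite eqEdim -memvE memvZ ?memv_line //=.
by rewrite !dim_vline scaler_eq0 (negPf x0).
Qed.

Lemma PG_line n (P : {vspace 'rV[K]_n.+1}) :
  PG n K P <-> exists2 u, u != 0 & P = <[u]>%VS.
Proof.
split=> [dP|[u u0 ->]]; last by rewrite /PG /= dim_vline u0.
have u0 : vpick P != 0 by rewrite vpick0 -dimv_eq0 dP.
exists (vpick P) => //; apply/eqP; rewrite eq_sym eqEdim -memvE memv_pick.
by rewrite dP dim_vline u0.
Qed.

Lemma projectivity_line n (A : 'M[K]_n.+1) w :
  projectivity A <[w]>%VS = <[w *m A]>%VS.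
Proof. by rewrite /projectivity limg_line lfunE. Qed.

End Lines.

(** * The Frobenius map of L over F *)

Section Frobenius.
Variables (F : finFieldType) (L : fieldExtType F).
Implicit Types (x y : L) (a : F).

Definition frobenius x : L := x ^+ #|F|.

Lemma frobenius_is_zmod_morphism : zmod_morphism frobenius.
Proof.
have [p p_pr pcharFp] := finPcharP F.
have pcharL : [pchar L].-nat #|F|.
  have pF : (p : nat_pred).-nat #|F|.
    by rewrite -cardsT; exact: (pprimeChar_pgroup pcharFp).
  by apply: sub_in_pnat pF => r _ /eqP ->; rewrite pchar_lalg.
have frobD x y : frobenius (x + y) = frobenius x + frobenius y.
  exact: exprDn_pchar.
by move=> x y; apply/eqP; rewrite eq_sym subr_eq -frobD subrK.
Qed.

Lemma frobenius_is_monoid_morphism : monoid_morphism frobenius.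
Proof. by split=> [|x y]; [exact: expr1n | exact: exprMn]. Qed.

HB.instance Definition _ :=
  GRing.isZmodMorphism.Build L L frobenius frobenius_is_zmod_morphism.
HB.instance Definition _ :=
  GRing.isMonoidMorphism.Build L L frobenius frobenius_is_monoid_morphism.

Lemma frobenius_alg a : frobenius a%:A = a%:A.
Proof. by rewrite /frobenius -in_algE -rmorphXn /= expf_card. Qed.

Lemma frobenius_fixed x : frobenius x = x -> exists a, x = a%:A.
Proof.
move=> xq; apply/vlineP.
by rewrite -[<[1]>%VS]/(1%VS) Fermat's_little_theorem dimv1 expn1; apply/eqP.
Qed.

(** The ratio of [x] and [y] is fixed by the Frobenius map, so it lies in [F]
    (unless [y] is zero). *)
Lemma frobenius_proportional x y :
  x * frobenius y = y * frobenius x ->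
  exists a b, ((a != 0) || (b != 0)) /\ a *: x + b *: y = 0.
Proof.
have [-> _|y0 xy] := eqVneq y 0.
  by exists 0, 1; rewrite oner_neq0 orbT scale0r scaler0 addr0.
have yq0 : frobenius y != 0 by rewrite fmorph_eq0.
have [|a xya] := @frobenius_fixed (x / y).
  rewrite fmorph_div; apply/eqP; rewrite eqr_div // mulrC -xy; exact/eqP.
exists 1, (- a); rewrite oner_neq0; split=> //.
by rewrite scale1r scaleNr -mulr_algl -xya divfK // subrr.
Qed.

(** In the quotient of the multiplicative group of [L] by that of [F], which has
    order q^2 + q + 1, raising to the power q + 1 is invertible, with inverse
    y |-> y^(q^2 + 1).  Concretely, for s = y^(q^2 + 1) the product s * s^q is y
    times its norm. *)
Lemma pow_frobenius_succ_onto (dimL : \dim {:L} = 3%N) y : y != 0 ->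
  exists s a, a != 0 /\ s * frobenius s = a *: y.
Proof.
move=> y0; have frob3 : frobenius (frobenius (frobenius y)) = y.
  have := Fermat's_little_theorem {:L}%AS y; rewrite memvf dimL => /esym/eqP.
  by rewrite /frobenius -!exprM !expnS expn0 muln1 mulnA.
pose N := y * frobenius y * frobenius (frobenius y).
have [|a Na] := @frobenius_fixed N.
  by rewrite /N !rmorphM /= frob3 mulrC mulrA.
exists (y * frobenius (frobenius y)), a; split.
  apply/eqP=> a0; move: Na; rewrite a0 scale0r => /eqP.
  by rewrite !mulf_eq0 !fmorph_eq0 (negPf y0).
by rewrite rmorphM /= frob3 -mulr_algl -Na /N; ring.
Qed.

End Frobenius.

(** * Coordinates with respect to the powers of a primitive element *)

Section PowerBasis.
Variables (F : finFieldType) (L : fieldExtType F).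
Hypothesis dimL : \dim {:L} = 3%N.
Variable tau : L.
Hypothesis tau_prim : (#|F| ^ 3 - 1)%N.-primitive_root tau.

(** The nonzero elements of [F] have order dividing q - 1, which is less than
    the order of [tau]. *)
Lemma primitive_notin_base : tau \notin 1%VS.
Proof.
have q1 : (1 < #|F|)%N := finNzRing_gt1 F.
apply/negP; rewrite Fermat's_little_theorem dimv1 expn1 => tauq.
have q3 : (#|F| < #|F| ^ 3)%N by rewrite -[X in (X < _)%N]expn1 ltn_exp2l.
have n0 : (0 < #|F| ^ 3 - 1)%N by rewrite subn_gt0 (ltn_trans q1).
have tau0 : tau != 0.
  apply/eqP=> tau0; move/eqP: (prim_expr_order tau_prim).
  by rewrite tau0 expr0n eqn0Ngt n0 eq_sym oner_eq0.
have: (#|F| ^ 3 - 1 %| #|F| - 1)%N.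
  rewrite (prim_order_dvd tau_prim) -(inj_eq (mulIf tau0)) mul1r -exprSr.
  by rewrite subn1 prednK ?(ltnW q1).
move/dvdn_leq; rewrite subn_gt0 => /(_ q1); apply/negP; rewrite -ltnNge.
by rewrite ltn_sub2r // (ltn_trans q1).
Qed.

(** The degree of [tau] divides 3 and is not 1, so it is 3, and no nonzero
    polynomial over [F] of degree at most 2 vanishes at [tau]. *)
Lemma powers_basis : basis_of {:L} [tuple tau ^+ j | j < 3].
Proof.
have deg3 : adjoin_degree 1 tau = 3%N.
  have := field_dimS (subvf <<1; tau>>); rewrite dim_Fadjoin dimv1 muln1 dimL.
  have := adjoin_deg_eq1 1 tau; rewrite (negPf primitive_notin_base).
  by rewrite dvdn_divisors // !inE => -> /eqP.
rewrite basisEfree subvf size_tuple dimL leqnn !andbT; apply/freeP=> k k0 i.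
pose p := \poly_(j < 3) k (inord j).
have: map_poly (in_alg L) p == 0.
  rewrite -(@root_small_adjoin_poly _ _ 1%AS tau _ (alg_polyOver 1 p));
    last by rewrite deg3 size_map_poly size_poly.
  apply/rootP; rewrite -[RHS]k0 (@horner_coef_wide _ 3);
    last by rewrite size_map_poly size_poly.
  apply: eq_bigr => j _; rewrite coef_map coef_poly ltn_ord inord_val.
  by rewrite -tnth_nth tnth_mktuple mulr_algl.
rewrite map_poly_eq0 => /eqP/(congr1 (fun r : {poly F} => r`_i)).
by rewrite coef_poly coef0 ltn_ord inord_val.
Qed.

Definition powers_col : 'cV[L]_3 := \col_j tau ^+ j.

Lemma bracketK x :
  map_mx (in_alg L) (bracket tau x) *m powers_col = x%:M.
Proof.
apply/rowP=> i; rewrite !mxE ord1 eqxx mulr1n.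
rewrite [in RHS](coord_basis powers_basis (memvf x)); apply: eq_bigr => j _.
by rewrite !mxE -tnth_nth tnth_mktuple mulr_algl.
Qed.

Lemma bracket_powers (v : 'rV[F]_3) :
  bracket tau ((map_mx (in_alg L) v *m powers_col) 0 0) = v.
Proof.
apply/rowP=> i; rewrite !mxE.
rewrite -[RHS](@coord_sum_free _ _ _ [tuple tau ^+ j | j < 3] (v 0) i);
  last exact: basis_free powers_basis.
congr (coord _ _ _); apply: eq_bigr => j _.
by rewrite !mxE -tnth_nth tnth_mktuple mulr_algl.
Qed.

End PowerBasis.

(** * Minors of a vector and its conjugate *)

Section Minors.
Variables (F : finFieldType) (L : fieldExtType F).
Implicit Types (w : 'rV[L]_3) (v : 'rV[F]_3) (l : 'I_3).

(** Indices in ['I_3] are added modulo 3, so that [l + 1] and [l + 1 + 1] are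
    the two indices other than [l]. *)
Lemma ord3_cycle l : l + 1 + 1 + 1 = l.
Proof. by apply/val_inj; case: l => -[|[|[|]]]. Qed.

Lemma ord3_uniq l : uniq [:: l; l + 1; l + 1 + 1].
Proof. by case: l => -[|[|[|]]]. Qed.

Lemma ord3_mem l i : i \in [:: l; l + 1; l + 1 + 1].
Proof. by case: l i => -[|[|[|]]] // ? [[|[|[|]]]]. Qed.

Lemma sum_ord3 (V : nmodType) (f : 'I_3 -> V) l :
  \sum_i f i = f l + f (l + 1) + f (l + 1 + 1).
Proof.
rewrite (eq_bigl (mem [:: l; l + 1; l + 1 + 1])); last first.
  by move=> i; rewrite /= ord3_mem.
by rewrite -big_uniq ?ord3_uniq //= !big_cons big_nil addr0 addrA.
Qed.

(** The entry of index [l] of the cross product of [w] and its conjugate. *)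
Definition frobenius_minor w l : L :=
  w 0 (l + 1) * frobenius (w 0 (l + 1 + 1))
  - w 0 (l + 1 + 1) * frobenius (w 0 (l + 1)).

Lemma frobenius_minorZ x w l :
  frobenius_minor (x *: w) l = x * frobenius x * frobenius_minor w l.
Proof. by rewrite /frobenius_minor !mxE !rmorphM /=; ring. Qed.

Lemma frobenius_minor_base v l : frobenius_minor (map_mx (in_alg L) v) l = 0.
Proof.
by rewrite /frobenius_minor !mxE /= !frobenius_alg mulrC subrr.
Qed.

(** Dividing [w] by one of its nonzero entries makes all its entries fixed by
    the Frobenius map. *)
Lemma frobenius_minors_eq0 w : w != 0 -> (forall l, frobenius_minor w l = 0) ->
  exists x v, w = x *: map_mx (in_alg L) v.
Proof.
move=> /rV0Pn [j wj0] w_minor.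
have wq0 : frobenius (w 0 j) != 0 by rewrite fmorph_eq0.
have ratio i : exists a, w 0 i / w 0 j == a%:A.
  have [|a /eqP] := @frobenius_fixed _ _ (w 0 i / w 0 j); last by exists a.
  rewrite fmorph_div; apply/eqP; rewrite eqr_div //.
  have := ord3_mem j i; rewrite !inE => /or3P[] /eqP ->; first by rewrite mulrC.
    (* The minor of index j + 2 involves the entries j and j + 1 of w. *)
    have /eqP := w_minor (j + 1 + 1).
    by rewrite /frobenius_minor ord3_cycle subr_eq0 mulrC.
  have /eqP := w_minor (j + 1).
  by rewrite /frobenius_minor ord3_cycle subr_eq0 eq_sym mulrC.
have [v wv] := fin_all_exists ratio.
exists (w 0 j), (\row_i v i); apply/rowP=> i.
by rewrite !mxE /= -(eqP (wv i)) mulrC divfK.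
Qed.

(** The vectors [w] with [w 0 l = 0] and [w *m c = 0] are the multiples of the
    cross product of [c] and the unit vector of index [l].  The entry at [l] is
    a factor in both minors of index other than [l], and the remaining minor
    takes the value [d] up to a factor in [F] by [pow_frobenius_succ_onto].
    Independence of the entries of [c] ensures that this minor does not vanish
    identically. *)
Lemma single_frobenius_minor (dimL : \dim {:L} = 3%N) (c : 'cV[L]_3) :
    (forall v, v != 0 -> map_mx (in_alg L) v *m c != 0) ->
  forall l d, d != 0 -> exists w a,
    [/\ a != 0, w *m c = 0, frobenius_minor w l = a *: d
      & forall l', l' != l -> frobenius_minor w l' = 0].
Proof.
move=> c_indep l d d0.
have := ord3_uniq l; rewrite /= !inE negb_or andbT.
case/andP=> /andP[l01 l02] l12.
pose w := \row_i (if i == l + 1 then c (l + 1 + 1) 0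
                  else if i == l + 1 + 1 then - c (l + 1) 0 else 0).
have w0 : w 0 l = 0 by rewrite mxE (negPf l01) (negPf l02).
have w1 : w 0 (l + 1) = c (l + 1 + 1) 0 by rewrite mxE eqxx.
have w2 : w 0 (l + 1 + 1) = - c (l + 1) 0.
  by rewrite mxE eqxx eq_sym (negPf l12).
have wc : w *m c = 0.
  apply/rowP=> i; rewrite !mxE (ord1 i) (sum_ord3 _ l) w0 w1 w2; ring.
have e0 : frobenius_minor w l != 0.
  (* Otherwise two entries of c satisfy a linear relation over F. *)
  apply/eqP => /eqP; rewrite /frobenius_minor subr_eq0 w1 w2 => /eqP.
  case/frobenius_proportional=> a [b [ab0 abc]].
  pose v := \row_i (if i == l + 1 then - b
                    else if i == l + 1 + 1 then a else 0).
  have v0 : v 0 l = 0 by rewrite mxE (negPf l01) (negPf l02).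
  have v1 : v 0 (l + 1) = - b by rewrite mxE eqxx.
  have v2 : v 0 (l + 1 + 1) = a by rewrite mxE eqxx eq_sym (negPf l12).
  have /c_indep/eqP[] : v != 0.
    apply: contraTneq ab0 => vz; move: v1 v2; rewrite vz !mxE => /eqP.
    by rewrite eq_sym oppr_eq0 => /eqP -> <-; rewrite eqxx.
  have vL k : map_mx (in_alg L) v 0 k = (v 0 k)%:A by rewrite mxE.
  apply/rowP=> i; rewrite !mxE (ord1 i) (sum_ord3 _ l) !vL v0 v1 v2 -[RHS]abc.
  by rewrite /= !mulr_algl scale0r add0r scaleNr scalerN addrC.
have [s [a [a0 sa]]] :=
  pow_frobenius_succ_onto dimL (mulf_neq0 d0 (invr_neq0 e0)).
exists (s *: w), a; split=> //.
- by rewrite -scalemxAl wc scaler0.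
- by rewrite frobenius_minorZ sa -scalerAl divfK.
move=> l' l'l; rewrite frobenius_minorZ.
have := ord3_mem l l'; rewrite !inE (negPf l'l) /= => /orP[] /eqP ->;
by rewrite /frobenius_minor !ord3_cycle w0 rmorph0 mulr0 mul0r subr0 mulr0.
Qed.

(** The entries of [u *m G] and their conjugates are both [F]-linear in [u],
    because the Frobenius map fixes [F]; a minor is thus bilinear in two copies
    of [u]. *)
Lemma frobenius_minor_quadratic n (G : 'M[L]_(n, 3)) (psi : {scalar L}) l :
  exists2 f : {mpoly F[n]}, f \is 2.-homog
    & forall u : 'rV[F]_n, f.@[fun i => u 0 i]
      = psi (frobenius_minor (map_mx (in_alg L) u *m G) l).
Proof.
pose B i j := G i (l + 1) * frobenius (G j (l + 1 + 1))
              - G i (l + 1 + 1) * frobenius (G j (l + 1)).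
exists (\sum_i \sum_j psi (B i j) *: ('X_i * 'X_j)).
  apply: rpred_sum => i _; apply: rpred_sum => j _; apply: rpredZ.
  by rewrite -mpolyXD dhomogX /= mdegD !mdeg1.
move=> u; have wq k : frobenius ((map_mx (in_alg L) u *m G) 0 k)
    = \sum_j (u 0 j)%:A * frobenius (G j k).
  rewrite mxE raddf_sum; apply: eq_bigr => j _.
  by rewrite /= rmorphM /= mxE /= frobenius_alg.
rewrite /frobenius_minor !wq !mxE !big_distrlr -sumrB !raddf_sum /=.
apply: eq_bigr => i _; rewrite -sumrB !raddf_sum; apply: eq_bigr => j _ /=.
rewrite mevalZ mevalM !mevalXU !mxE -[LHS]mulrC -linearZ_LR; congr (psi _).
by rewrite -[LHS]mulr_algl -(in_algE L) (rmorphM (in_alg L)) /= /B; ring.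
Qed.

End Minors.

(** * The Bruck-Bose correspondence on vectors *)

Section Coordinates.
Variables (F : finFieldType) (L : fieldExtType F).
Hypothesis dimL : \dim {:L} = 3%N.
Variable tau : L.
Hypothesis tau_prim : (#|F| ^ 3 - 1)%N.-primitive_root tau.
Implicit Types (alpha beta : L) (z : F).

Definition affine_vec alpha beta gamma : 'rV[L]_3 :=
  \row_(i < 3) [:: alpha; beta; gamma]`_i.

Definition bruck_bose_vec alpha beta z : 'rV[F]_7 :=
  row_mx (row_mx (bracket tau alpha) (bracket tau beta)) (const_mx z)
    : 'rV[F]_(3 + 3 + 1).

(** The extension of scalars to [L] of the [F]-linear map that sends the vector
    ([bracket tau alpha], [bracket tau beta], z) of F^7 to (alpha, beta, z) in
    L^3. *)
Definition bruck_bose_mx : 'M[L]_(7, 3) :=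
  block_mx (block_mx (powers_col tau) 0 0 (powers_col tau)) 0 0 1%:M
    : 'M[L]_(3 + 3 + 1, 1 + 1 + 1).

Lemma affine_vecE (w : 'rV[L]_3) : w = affine_vec (w 0 0) (w 0 1) (w 0 ord_max).
Proof.
apply/rowP=> -[[|[|[|]]] i3] //; rewrite mxE /=;
  by congr (w 0 _); apply/val_inj.
Qed.

Lemma affine_vecZ (x : L) alpha beta gamma :
  x *: affine_vec alpha beta gamma
    = affine_vec (x * alpha) (x * beta) (x * gamma).
Proof. by apply/rowP=> -[[|[|[|]]] i3] //; rewrite !mxE. Qed.

Lemma bruck_bose_vec_mx alpha beta z :
  map_mx (in_alg L) (bruck_bose_vec alpha beta z) *m bruck_bose_mx
    = affine_vec alpha beta z%:A.
Proof.
rewrite /bruck_bose_vec /bruck_bose_mx.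
rewrite (@map_row_mx _ _ _ 1 (3 + 3)%N) map_row_mx.
rewrite (@mul_row_block _ _ (3 + 3)%N 1 (1 + 1)%N 1) !mulmx0 addr0 add0r mulmx1.
rewrite mul_row_block !mulmx0 addr0 add0r !(bracketK dimL tau_prim).
apply/rowP=> i; rewrite [in RHS]mxE mxE.
case: (@splitP (1 + 1)%N 1 i) => [j ->|j ->]; last by rewrite !mxE (ord1 j).
by rewrite mxE; case: splitP => k ->; rewrite mxE (ord1 k) eqxx mulr1n.
Qed.

Lemma bruck_bose_vecP (u : 'rV[F]_7) :
  exists alpha beta z, u = bruck_bose_vec alpha beta z.
Proof.
pose u' : 'rV[F]_(3 + 3 + 1) := u.
pose val3 (v : 'rV[F]_3) := (map_mx (in_alg L) v *m powers_col tau) 0 0.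
exists (val3 (lsubmx (lsubmx u'))), (val3 (rsubmx (lsubmx u'))).
exists (rsubmx u' 0 0).
rewrite /bruck_bose_vec !(bracket_powers dimL tau_prim) hsubmxK.
have -> : const_mx (rsubmx u' 0 0) = rsubmx u'.
  by apply/rowP=> i; rewrite mxE (ord1 i).
by rewrite hsubmxK.
Qed.

Lemma bruck_bose_vecZ (x : F) alpha beta z :
  x *: bruck_bose_vec alpha beta z
    = bruck_bose_vec (x *: alpha) (x *: beta) (x * z).
Proof.
have brZ y : x *: bracket tau y = bracket tau (x *: y).
  by apply/rowP=> i; rewrite !mxE linearZ.
rewrite /bruck_bose_vec -!brZ (@scale_row_mx _ _ (3 + 3)%N) scale_row_mx.
by rewrite scalemx_const.
Qed.

End Coordinates.

(** * Subplanes exterior to the line at infinity *)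

Section Subplane.
Variables (F : finFieldType) (L : fieldExtType F).

Lemma subplane_line (A : 'M[L]_3) (w : 'rV[L]_3) :
  (projectivity A @` canonical_subplane L) <[w]>%VS
  <-> exists2 v : 'rV[F]_3, v != 0
      & <[w]>%VS = <[map_mx (in_alg L) v *m A]>%VS.
Proof.
split=> [[_ [v v0 <-]]|[v v0 ->]].
  by rewrite projectivity_line => <-; exists v.
by exists <[map_mx (in_alg L) v]>%VS; [exists v|exact: projectivity_line].
Qed.

(** The product of [v] with the last column of [A] is the third coordinate of a
    point of the subplane, so it does not vanish. *)
Lemma exterior_col_free (A : 'M[L]_3) :
    A \in unitmx -> exterior (projectivity A @` canonical_subplane L) ->
  forall v : 'rV[F]_3, v != 0 -> map_mx (in_alg L) v *m col ord_max A != 0.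
Proof.
move=> A_unit A_ext v v0; apply/eqP=> vA0.
have w0 : map_mx (in_alg L) v *m A != 0.
  by rewrite mulmx_free_eq0 ?row_free_unit // map_mx_eq0.
suff: set0 <[map_mx (in_alg L) v *m A]>%VS by [].
rewrite -A_ext; split; first by apply/subplane_line; exists v.
split; first by apply/PG_line; exists (map_mx (in_alg L) v *m A).
move=> _ /vlineP[x ->]; rewrite mxE.
by rewrite -mulmx_col vA0 mxE mulr0.
Qed.

End Subplane.

(** * The nine quadrics *)

Theorem theorem4p1 (F : finFieldType) (L : fieldExtType F)
    (dimL : \dim {:L} = 3%N)
    (tau : L) (tau_prim : (#|F| ^ 3 - 1)%N.-primitive_root tau)
    (pi : set {vspace 'rV[L]_3}) (pi_subplane : is_subplane pi)
    (pi_ext : exterior pi) :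
  exists Q : 'I_9 -> set {vspace 'rV[F]_7},
    [/\ forall i, is_quadric (Q i), injective Q &
        bruck_bose tau pi = \bigcap_(i in [set: 'I_9]) Q i].
Proof.
case: pi_subplane => A A_unit pi_eq; rewrite pi_eq in pi_ext *.
have c_free := exterior_col_free A_unit pi_ext.
pose X : 3.-tuple L := [tuple tau ^+ j | j < 3].
have X_basis : basis_of {:L} X := powers_basis dimL tau_prim.
pose w (u : 'rV[F]_7) : 'rV[L]_3 :=
  map_mx (in_alg L) u *m (bruck_bose_mx tau *m invmx A).
have wE alpha beta z : w (bruck_bose_vec tau alpha beta z)
    = affine_vec alpha beta z%:A *m invmx A.
  by rewrite /w mulmxA bruck_bose_vec_mx.
have w0 : w 0 = 0 by rewrite /w map_mx0 mul0mx.
have w_eq0 u : w u = 0 -> u = 0.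
  have [alpha [beta [z ->]]] := bruck_bose_vecP dimL tau_prim u.
  rewrite wE => /(congr1 (mulmxr A)); rewrite /= mulmxKV // mul0mx => /rowP h0.
  have := h0 0; have := h0 1; have := h0 ord_max; rewrite !mxE /=.
  move=> /eqP; rewrite scaler_eq0 oner_eq0 orbF => /eqP -> -> ->.
  have := bruck_bose_vecZ tau 0 0 0 0.
  by rewrite !scale0r mul0r => <-.
have [f f_homog fE] : exists2 f : 'I_3 * 'I_3 -> {mpoly F[7]},
    forall lk, f lk \is 2.-homog
  & forall lk (u : 'rV[F]_7), (f lk).@[fun i => u 0 i]
      = coord X lk.2 (frobenius_minor (w u) lk.1).
  have /fin_all_exists2 [f fh fE] (lk : 'I_3 * 'I_3) :=
    frobenius_minor_quadratic (bruck_bose_mx tau *m invmx A)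
      (coord X lk.2 : {scalar L}) lk.1.
  by exists f.
(* The forms are homogeneous, so one vector decides membership of a point. *)
have locus_line lk (u : 'rV[F]_7) : u != 0 ->
    zero_locus (f lk) <[u]>%VS <-> (f lk).@[fun i => u 0 i] = 0.
  move=> u0; split=> [[_ fu0]|fu0]; first exact/fu0/memv_line.
  split=> [|_ /vlineP[x ->]]; first by apply/PG_line; exists u.
  rewrite fE; have -> : w (x *: u) = x%:A *: w u.
    by rewrite /w map_mxZ -scalemxAl.
  rewrite frobenius_minorZ frobenius_alg -in_algE -rmorphM /= mulr_algl.
  by rewrite linearZ /= -fE fu0 mulr0.
(* A point off the quadric of each form that lies on the other eight shows at
   once that the nine forms are nonzero and their quadrics distinct. *)
have isolate lk : exists2 u : 'rV[F]_7, u != 0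
    & forall lk', ((f lk').@[fun i => u 0 i] == 0) = (lk' != lk).
  have Xk0 : X`_lk.2 != 0.
    by apply: (free_not0 (basis_free X_basis)); rewrite -tnth_nth mem_tnth.
  have [y [a [a0 yc y_l y_l']]] := single_frobenius_minor dimL c_free lk.1 Xk0.
  pose h := y *m A.
  pose u := bruck_bose_vec tau (h 0 0) (h 0 1) 0.
  have wu : w u = y.
    rewrite wE scale0r.
    have -> : 0 = h 0 ord_max by rewrite /h -mulmx_col yc mxE.
    by rewrite -affine_vecE mulmxK.
  have fu lk' : ((f lk').@[fun i => u 0 i] == 0) = (lk' != lk).
    rewrite fE wu; case: lk' => l' k' /=; rewrite -pair_eqE /= /pair_eq /=.
    case: (eqVneq l' lk.1) => [->|l'l]; last by rewrite y_l' // linear0 eqxx.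
    rewrite y_l linearZ /= mulf_eq0 (negPf a0) /=.
    rewrite coord_free ?(basis_free X_basis) //.
    by rewrite (eq_sym lk.2); case: (k' == lk.2); rewrite /= ?oner_eq0 ?eqxx.
  exists u => //; apply/eqP=> u0; have := fu lk.
  by rewrite fE u0 w0 /frobenius_minor !mxE !mul0r subrr linear0 !eqxx.
have [e e_bij] : exists e : 'I_9 -> 'I_3 * 'I_3, bijective e.
  have card9 : 9 = #|{: 'I_3 * 'I_3}| by rewrite card_prod card_ord.
  exists (fun i => enum_val (cast_ord card9 i)).
  apply: bij_comp; first exact: enum_val_bij.
  exact: (Bijective (cast_ordK card9) (cast_ordKV card9)).
exists (fun i => zero_locus (f (e i))); split=> [i|i j Qij|].
- exists (f (e i)); split=> //.
  have [u _ fu] := isolate (e i); apply/eqP=> f0; have := fu (e i).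
  by rewrite f0 meval0 !eqxx.
- have [u u0 fu] := isolate (e i); apply/(bij_inj e_bij)/esym/eqP.
  rewrite -[_ == _]negbK -fu; apply/negP=> /eqP/(locus_line _ _ u0).
  by rewrite -Qij => /(locus_line _ _ u0)/eqP; rewrite fu eqxx.
apply/seteqP; split=> P.
  case=> alpha [beta [piP ->]] i _.
  have /subplane_line[v v0 lineE] : (projectivity A @` canonical_subplane L)
    <[affine_vec alpha beta 1]>%VS := piP.
  have /vlineP[x affE] :
      affine_vec alpha beta 1 \in <[map_mx (in_alg L) v *m A]>%VS.
    by rewrite -lineE memv_line.
  have wu : w (bruck_bose_vec tau alpha beta 1) = x *: map_mx (in_alg L) v.
    by rewrite wE scale1r affE -scalemxAl mulmxK.
  have u_neq0 : bruck_bose_vec tau alpha beta 1 != 0.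
    apply/eqP=> u0; have : affine_vec alpha beta 1 = 0.
      by rewrite affE scalemxAl -wu u0 w0 mul0mx.
    by move/rowP/(_ ord_max); rewrite !mxE /= => /eqP; rewrite oner_eq0.
  apply/(locus_line _ _ u_neq0).
  by rewrite fE wu frobenius_minorZ frobenius_minor_base mulr0 linear0.
move=> QP; have [|u u0 uP] := (PG_line P).1; first by have [] := QP ord0 I.
have wu0 : w u != 0 by apply: contraNneq u0 => /w_eq0 ->.
have minors0 l : frobenius_minor (w u) l = 0.
  rewrite (coord_basis X_basis (memvf (frobenius_minor _ _))) big1 // => k _.
  have [e' _ eK] := e_bij.
  have := QP (e' (l, k)) I; rewrite uP eK => /(locus_line _ _ u0).
  by rewrite fE /= => ->; rewrite scale0r.
have [x [v wuE]] := frobenius_minors_eq0 wu0 minors0.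
have v0 : v != 0 by apply: contraNneq wu0 => v0; rewrite wuE v0 map_mx0 scaler0.
have x0 : x != 0 by apply: contraNneq wu0 => x0; rewrite wuE x0 scale0r.
have [alpha [beta [z uE]]] := bruck_bose_vecP dimL tau_prim u.
have affE : affine_vec alpha beta z%:A = x *: (map_mx (in_alg L) v *m A).
  by rewrite scalemxAl -wuE uE wE mulmxKV.
(* A common point with z = 0 would give a subplane point at infinity. *)
have z0 : z != 0.
  apply: contraNneq (c_free v v0) => z0; apply/eqP/colP=> i.
  rewrite (ord1 i) mulmx_col [RHS]mxE; apply: (mulfI x0); rewrite mulr0.
  by have /rowP/(_ ord_max) := affE; rewrite z0 scale0r mxE /= [RHS]mxE.
have zA0 : (z^-1)%:A != 0 :> L by rewrite scaler_eq0 oner_eq0 orbF invr_eq0.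
exists (z^-1 *: alpha), (z^-1 *: beta); split.
  have -> : affine_point (z^-1 *: alpha) (z^-1 *: beta)
      = <[(z^-1)%:A *: affine_vec alpha beta z%:A]>%VS.
    by rewrite affine_vecZ !mulr_algl scalerA mulVf // scale1r.
  rewrite vlineZ //; apply/subplane_line; exists v => //.
  by rewrite affE vlineZ.
by rewrite uP -(vlineZ u (x := z^-1)) ?invr_eq0 // uE bruck_bose_vecZ mulVf.
Qed.
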